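(* Let $\mathbb{F}$ be a field and let $L$ be a nilpotent symplectic alternating algebra over $\mathbb{F}$ of dimension $10$ with an isotropic centre of dimension $3$ that has the further properties that $\dim L^{3}=6$, $L^{3}L^{2}=L^{5}$ and $L$ is of type A. Then $L$ has a presentation of the form $$\mathcal{P}_{10}^{(3,6)}(r):\ (x_{2}y_{4},y_{5})=r,\ (x_{1}y_{2},y_{4})=1,\ (y_{1}y_{2},y_{5})=1,\ (y_{1}y_{3},y_{5})=1$$ where $r\in\mathbb{F}$, $r\neq 0$. Furthermore, for $r,s\in\mathbb{F}\setminus\{0\}$, the presentations $\mathcal{P}_{10}^{(3,6)}(r)$ and $\mathcal{P}_{10}^{(3,6)}(s)$ describe the same algebra (up to isomorphism) if and only if $s/r\in(\mathbb{F}^{*})^{3}$.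
   Context: A symplectic alternating algebra (SAA) over a field $\mathbb{F}$ is a finite-dimensional $\mathbb{F}$-vector space $L$ with a non-degenerate alternating bilinear form $(\ ,\ )$ and a bilinear alternating product $L\times L\to L$, $(x,y)\mapsto xy$ (so $xx=0$), such that $(xy,z)=(yz,x)$ for all $x,y,z\in L$. It follows that $(x,y,z)\mapsto (xy,z)$ is an alternating trilinear form. Isomorphisms of SAAs are linear bijections preserving the form and the product. For subspaces $A,B$, $AB$ denotes the linear span of all products $ab$ with $a\in A,b\in B$. The lower central series is $L^1=L$, $L^{k+1}=L^k L$; the upper central series is $Z_0(L)=0$, $Z_{k+1}(L)=\{x\in L: xL\leq Z_k(L)\}$, with $Z(L)=Z_1(L)$ the centre. $L$ is nilpotent if $L^{k}=0$ for some $k$. A subspace is isotropic if the form vanishes identically on it. A standard basis of a $10$-dimensional SAA is a basis $x_1,y_1,\ldots,x_5,y_5$ with $(x_i,x_j)=(y_i,y_j)=0$ and $(x_i,y_j)=\delta_{ij}$ for all $i,j$. A presentation lists values of triples $(uv,w)$ with $u,v,w$ distinct elements of a standard basis; the convention is that all triple values of basis elements not listed (and not determined from the listed ones by the alternating property) are $0$. Such data determine the product, hence the SAA, uniquely. $\mathbb{F}^{*}=\mathbb{F}\setminus\{0\}$ and $(\mathbb{F}^{*})^{3}=\{b^3: b\in\mathbb{F}^{*}\}$. Types. Let $L$ be a nilpotent SAA of dimension $10$ with isotropic centre of dimension $3$, $\dim L^3=6$ and $L^3L^2=L^5$. Then one can choose a standard basis adapted to the central series in the sense that $L^{5}=\mathbb{F}x_{5}+\mathbb{F}x_{4}$,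 $Z(L)=L^5+\mathbb{F}x_{3}$, $Z_{2}(L)=L^{4}=Z(L)+\mathbb{F}x_{2}$, $Z_{3}(L)=L^{3}=L^4+\mathbb{F}x_{1}+\mathbb{F}y_{1}$, $L^{2}=L^{3}+\mathbb{F}y_{2}$, $Z_{4}(L)=L^{3}+\mathbb{F}y_{2}+\mathbb{F}y_{3}$. Since $L^4Z_4(L)=0$, the linear maps $\phi,\psi: L^{3}/L^{4}\to L^{5}$, $\phi(u+L^4)=uy_2$, $\psi(u+L^4)=uy_3$, are well defined; $\phi$ is bijective because $L^3L^2=L^5$. Put $\tau=\psi\phi^{-1}:L^5\to L^5$. The minimal polynomial of $\tau$ has degree $2$, and exactly one of the following holds, independently of the choice of adapted standard basis: type A: the minimal polynomial of $\tau$ has two distinct roots in $\mathbb{F}$; type B: it has a double root in $\mathbb{F}$; type C: it is irreducible in $\mathbb{F}[t]$. *)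

(* Defs.v *)
From HB Require Import structures.
From mathcomp Require Import all_boot all_order all_algebra.
From mathcomp Require Import ring zify.

Set Implicit Arguments.
Unset Strict Implicit.
Unset Printing Implicit Defensive.

Import GRing.Theory.
Local Open Scope ring_scope.

Record saa (F : fieldType) := Saa {
  saa_sort :> vectType F;
  sform : {biscalar saa_sort};
  prd : {bilinear saa_sort -> saa_sort -> saa_sort};
  formxx : forall x, sform x x = 0;
  form_nondeg : forall x, (forall y, sform x y = 0) -> x = 0;
  prdxx : forall x, prd x x = 0;
  form_prd : forall x y z, sform (prd x y) z = sform (prd y z) x
}.

Arguments sform {F s}.
Arguments prd {F s}.

Definition saa_iso (F : fieldType) (L M : saa F) : Prop :=
  exists f : {linear L -> M},
    [/\ bijective f,
        forall u v, sform (f u) (f v) = sform u v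
      & forall u v, f (prd u v) = prd (f u) (f v)].

Section CentralSeries.
Variables (F : fieldType) (L : saa F).
Implicit Types (A B U W : {vspace L}).

Definition mulV A B : {vspace L} :=
  <<[seq prd a b | a <- vbasis A, b <- vbasis B]>>%VS.

Lemma mulVP A B W :
  reflect (forall a b, a \in A -> b \in B -> prd a b \in W) (mulV A B <= W)%VS.
Proof.
apply: (iffP span_subvP) => [sub a b aA bB | sub _ /allpairsP[[a b] /= [aA bB ->]]].
  rewrite (coord_vbasis aA) (coord_vbasis bB) linear_sumlz.
  apply: memv_suml => i _; rewrite linear_sumr; apply: memv_suml => j _.
  rewrite linearZl_LR linearZr_LR; do 2!apply: memvZ.
  apply: sub; apply/allpairsP; exists ((vbasis A)`_i, (vbasis B)`_j).
  by split=> //; rewrite mem_nth ?size_tuple.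
by apply: sub; apply: vbasis_mem.
Qed.

(* Indexed so that lcs 1 = L; lcs 0 = L as well. *)
Definition lcs (k : nat) : {vspace L} :=
  iter k.-1 (fun U => mulV U fullv) fullv.

Definition right_mul (y : L) : 'End(L) := linfun (applyr prd y).

Lemma right_mulE x y : right_mul y x = prd x y.
Proof. by rewrite lfunE. Qed.

Definition ann_mod U : {vspace L} :=
  (\bigcap_(y <- vbasis (fullv : {vspace L})) (right_mul y @^-1: U))%VS.

Lemma mem_ann_mod U x : reflect (forall y, prd x y \in U) (x \in ann_mod U).
Proof.
have -> : (x \in ann_mod U) =
    all (fun y => prd x y \in U) (vbasis (fullv : {vspace L})).
  rewrite /ann_mod; elim: (tval _) => [|y s IH] /=.
    by rewrite big_nil memvf.
  by rewrite big_cons memv_cap IH -memv_preim right_mulE.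
apply: (iffP allP) => [sub y | sub y _]; last exact: sub.
rewrite (coord_vbasis (memvf y)) linear_sumr; apply: memv_suml => i _.
by rewrite linearZr_LR memvZ // sub // mem_nth ?size_tuple.
Qed.

Definition ucs (k : nat) : {vspace L} := iter k ann_mod 0%VS.

Definition centre : {vspace L} := ucs 1.

Definition nilpotent_saa : Prop := exists k, lcs k = 0%VS.

Definition isotropic U : Prop := {in U &, forall u v, sform u v = 0}.

End CentralSeries.

Section StandardBasis.

Definition bidx : Type := ('I_5 + 'I_5)%type.

(* Labels of x_1, ..., x_5 and y_1, ..., y_5, numbered from 1. *)
Definition X (k : nat) : bidx := inl (inZp k.-1).
Definition Y (k : nat) : bidx := inr (inZp k.-1).

Variables (F : fieldType) (L : saa F).

Definition standard_basis (e : bidx -> L) : Prop :=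
  basis_of fullv (codom e) /\
  forall i j : 'I_5,
    [/\ sform (e (inl i)) (e (inl j)) = 0,
        sform (e (inr i)) (e (inr j)) = 0
      & sform (e (inl i)) (e (inr j)) = (i == j)%:R].

Definition adapted (e : bidx -> L) : Prop :=
  [/\ lcs L 5 = (<[e (X 5)]> + <[e (X 4)]>)%VS,
      centre L = (lcs L 5 + <[e (X 3)]>)%VS,
      ucs L 2 = lcs L 4 /\ lcs L 4 = (centre L + <[e (X 2)]>)%VS,
      ucs L 3 = lcs L 3 /\ lcs L 3 = (lcs L 4 + <[e (X 1)]> + <[e (Y 1)]>)%VS
    & lcs L 2 = (lcs L 3 + <[e (Y 2)]>)%VS /\
      ucs L 4 = (lcs L 3 + <[e (Y 2)]> + <[e (Y 3)]>)%VS].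

End StandardBasis.

Section TypeA.
Variables (F : fieldType) (L : saa F).

(* For y in Z_4(L), the map L^3 -> L^5, u |-> u y. It vanishes on L^4 because
   L^4 Z_4(L) = 0, so it is the projection L^3 -> L^3/L^4 followed by the map
   induced on the quotient. vsproj only records that u y lies in L^5. *)
Definition mul35 (y : L) : 'Hom(subvs_of (lcs L 3), subvs_of (lcs L 5)) :=
  (linfun (vsproj (lcs L 5)) \o right_mul y \o linfun vsval)%VF.

(* tau = psi phi^-1 with phi = mul35 (e (Y 2)), psi = mul35 (e (Y 3)) and phi^-1
   a linear section of phi. Two sections differ by a map into L^4 = ker phi,
   which psi kills, so the choice does not matter; tauE below confirms that
   tau (u y_2) = u y_3 for all u in L^3. *)
Definition tau (e : bidx -> L) : 'End(subvs_of (lcs L 5)) :=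
  (mul35 (e (Y 3)) \o (mul35 (e (Y 2)))^-1)%VF.

Lemma prdC (x y : L) : prd x y = - prd y x.
Proof.
apply/eqP; rewrite -addr_eq0; apply/eqP; have := prdxx (x + y).
by rewrite linearDl !linearDr !prdxx add0r addr0.
Qed.

Lemma sformC (x y : L) : sform x y = - sform y x.
Proof.
apply/eqP; rewrite -addr_eq0; apply/eqP; have := formxx (x + y).
by rewrite linearDl !linearDr !formxx add0r addr0.
Qed.

Lemma lcs_ucs0 k (a z : L) :
  a \in lcs L k.+1 -> z \in ucs L k.+1 -> prd a z = 0.
Proof.
elim: k a z => [|k IH] a z.
  move=> _ /mem_ann_mod/(_ a); rewrite memv0 => /eqP za.
  by rewrite prdC za oppr0.
move=> aL zZ.
have sub : (lcs L k.+2 <= lker (right_mul z))%VS.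
  apply/mulVP => b c bL _; rewrite memv_ker right_mulE; apply/eqP.
  apply: form_nondeg => w; rewrite form_prd sformC form_prd form_prd.
  have zwZ : prd z w \in ucs L k.+1 by move/mem_ann_mod: zZ; apply.
  by rewrite prdC (IH _ _ bL zwZ) oppr0 linear0l oppr0.
by move/subvP/(_ _ aL): sub; rewrite memv_ker right_mulE => /eqP.
Qed.

Variable e : bidx -> L.
Hypotheses (se : standard_basis e) (ae : adapted e).
Hypothesis L32 : mulV (lcs L 3) (lcs L 2) = lcs L 5.

Let y2 := e (Y 2).
Let y3 := e (Y 3).

Lemma L33 u v : u \in lcs L 3 -> v \in lcs L 3 -> prd u v = 0.
Proof.
case: ae => _ _ _ [Z3 _] _ uL; rewrite -Z3; exact: lcs_ucs0.
Qed.

Lemma y2_L2 : y2 \in lcs L 2.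
Proof.
by case: ae => _ _ _ _ [-> _]; apply: subvP (memv_line _); apply: addvSr.
Qed.

Lemma L3_y2 u : u \in lcs L 3 -> prd u y2 \in lcs L 5.
Proof.
by move=> uL; rewrite -L32; move: (subvv (mulV (lcs L 3) (lcs L 2))) => /mulVP;
   apply => //; apply: y2_L2.
Qed.

Lemma L5_y3 v : v \in lcs L 5 -> sform v y3 = 0.
Proof.
case: ae => -> _ _ _ _ /memv_addP[_ /vlineP[a ->] [_ /vlineP[b ->] ->]].
case: se => _ st.
rewrite linearDl !linearZl_LR /= /y3 /X /Y.
by case: (st (inZp 4) (inZp 2)) (st (inZp 3) (inZp 2)) => _ _ -> [_ _ ->];
  rewrite !mulr0 addr0.
Qed.

Lemma sform_u3 u b : u \in lcs L 3 -> b \in ucs L 4 -> sform (prd u y3) b = 0.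
Proof.
move=> uL; case: (ae) => _ _ _ _ [_ ->].
case/memv_addP => [c /memv_addP[d dL [_ /vlineP[a ->] ->]] [_ /vlineP[a' ->] ->]].
rewrite !linearDr !linearZr_LR /= -/y2 -/y3.
have -> : sform (prd u y3) d = 0 by rewrite -form_prd L33 // linear0l.
have -> : sform (prd u y3) y2 = 0.
  by rewrite form_prd form_prd prdC linearNl L5_y3 ?L3_y2 // oppr0.
by rewrite form_prd prdxx linear0l !mulr0 !addr0.
Qed.

Lemma bidxP (P : bidx -> Prop) :
  (forall k, (0 < k <= 5)%N -> P (X k)) -> (forall k, (0 < k <= 5)%N -> P (Y k)) ->
  forall b, P b.
Proof.
have iE (i : 'I_5) : i = inZp i.+1.-1 by apply: val_inj; rewrite /= modn_small.
move=> PX PY [i|i]; rewrite (iE i); [apply: PX|apply: PY]; exact: ltn_ord.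
Qed.

Lemma mem_mid (U W : {vspace L}) x : x \in (U + <[x]> + W)%VS.
Proof.
by apply: (subvP (addvSl _ _)); apply: (subvP (addvSr _ _)); apply: memv_line.
Qed.

Lemma X_Z4 k : (0 < k <= 5)%N -> e (X k) \in ucs L 4.
Proof.
case: (ae) => E5 E1 [_ E4] [_ E3] [_ ->].
have s34 : (lcs L 3 <= lcs L 3 + <[e (Y 2)]> + <[e (Y 3)]>)%VS.
  by rewrite -addvA addvSl.
have s43 : (lcs L 4 <= lcs L 3)%VS by rewrite E3 -addvA addvSl.
have s14 : (centre L <= lcs L 4)%VS by rewrite E4 addvSl.
have s51 : (lcs L 5 <= centre L)%VS by rewrite E1 addvSl.
move=> kP; apply: (subvP s34).
case: k kP => [|[|[|[|[|[|]]]]]] // _.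
- by rewrite E3 mem_mid.
- apply: (subvP s43); rewrite E4; apply: subvP (memv_line _); exact: addvSr.
- apply/(subvP s43)/(subvP s14); rewrite E1.
  by apply: subvP (memv_line _); exact: addvSr.
- apply/(subvP s43)/(subvP s14)/(subvP s51); rewrite E5.
  by apply: subvP (memv_line _); exact: addvSr.
- apply/(subvP s43)/(subvP s14)/(subvP s51); rewrite E5.
  by apply: subvP (memv_line _); exact: addvSl.
Qed.

Lemma Y_Z4 k : (0 < k <= 3)%N -> e (Y k) \in ucs L 4.
Proof.
case: (ae) => _ _ _ [_ E3] [_ ->].
case: k => [|[|[|[|]]]] // _.
- rewrite -addvA; apply: (subvP (addvSl _ _)); rewrite E3.
  by apply: subvP (memv_line _); exact: addvSr.
- exact: mem_mid.
- by apply: subvP (memv_line _); exact: addvSr.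
Qed.

Lemma orth0 v : (forall b, sform v (e b) = 0) -> v = 0.
Proof.
move=> v0; apply: form_nondeg => w; case: (se) => bs _.
have : w \in <<codom e>>%VS by rewrite (span_basis bs) memvf.
rewrite -[codom e]in_tupleE => /coord_span ->.
rewrite linear_sumr big1 // => i _; rewrite linearZr_LR /=.
have /codomP[b ->] : (in_tuple (codom e))`_i \in codom e by rewrite mem_nth.
by rewrite v0 mulr0.
Qed.

Lemma L3_y3 u : u \in lcs L 3 -> prd u y3 \in lcs L 5.
Proof.
move=> uL; have orth b := @sform_u3 u b uL; set v := prd u y3 in orth *.
pose x4 := e (X 4); pose x5 := e (X 5).
have <- : sform v (e (Y 5)) *: x5 + sform v (e (Y 4)) *: x4 = v.
  apply/eqP; rewrite -subr_eq0; apply/eqP; apply: orth0.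
  case: (se) => _ st; apply: bidxP => k kP.
    rewrite linearBl linearDl !linearZl_LR /= (orth _ (X_Z4 kP)) /x4 /x5 /X.
    by case: (st (inZp 4) (inZp k.-1)) (st (inZp 3) (inZp k.-1)) => -> _ _ [-> _ _];
      rewrite !mulr0 addr0 subr0.
  rewrite linearBl linearDl !linearZl_LR /= /x4 /x5 /X.
  case: (st (inZp 4) (inZp k.-1)) (st (inZp 3) (inZp k.-1)) => _ _ E5 [_ _ E4].
  rewrite -/(Y k) in E5 E4; rewrite E5 E4.
  case: k kP {E5 E4} => [|[|[|[|[|[|]]]]]] // _; rewrite -?val_eqE /= ?mulr0 ?mulr1 ?add0r ?addr0 ?subrr //.
  - by rewrite (orth _ (@Y_Z4 1 isT)) oppr0.
  - by rewrite (orth _ (@Y_Z4 2 isT)) oppr0.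
  - by rewrite (orth _ (@Y_Z4 3 isT)) oppr0.
case: (ae) => -> _ _ _ _.
by apply: memv_add; apply: memvZ; apply: memv_line.
Qed.

Lemma ker_y2 u : u \in lcs L 3 -> prd u y2 = 0 -> prd u y3 = 0.
Proof.
case: (ae) => E5 _ [_ E4] [_ E3] [E2 E4'].
pose x1 := e (X 1); pose y1 := e (Y 1).
have x1L : x1 \in lcs L 3.
  by rewrite E3 mem_mid.
have y1L : y1 \in lcs L 3.
  rewrite E3; apply: subvP (memv_line _); exact: addvSr.
have kill d z : d \in lcs L 4 -> z \in ucs L 4 -> prd d z = 0 by exact: lcs_ucs0.
have sub : (lcs L 5 <= <<[:: prd x1 y2; prd y1 y2]>>)%VS.
  rewrite -L32; apply/mulVP => a b; rewrite {1}E3 E2.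
  case/memv_addP => [c /memv_addP[d dL [_ /vlineP[s ->] ->]] [_ /vlineP[t ->] ->]].
  case/memv_addP => [b' b'L [_ /vlineP[q ->] ->]].
  have y2Z := @Y_Z4 2 isT; rewrite -/x1 -/y1 -/y2 in y2Z *.
  have aL : d + s *: x1 + t *: y1 \in lcs L 3.
    by rewrite E3; do 2!(apply: memv_add; rewrite ?memvZ ?memv_line //).
  rewrite linearDr (L33 aL b'L) add0r linearZr_LR /= !linearDl !linearZl_LR /=.
  rewrite (kill _ _ dL y2Z) add0r span_cons span_seq1.
  by apply: memvZ; apply: memv_add; apply: memvZ; apply: memv_line.
have d5 : \dim (lcs L 5) = 2.
  have -> : lcs L 5 = <<[:: e (X 5); e (X 4)]>>%VS by rewrite E5 span_cons span_seq1.
  apply/eqP; rewrite -/(size [:: e (X 5); e (X 4)]) -/(free _).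
  case: (se) => _ st; rewrite free_cons seq1_free span_seq1; apply/andP; split.
    apply/negP => /vlineP[a Ea]; have [_ _ E55] := st (inZp 4) (inZp 4).
    have [_ _ E45] := st (inZp 3) (inZp 4); move: E55.
    rewrite eqxx -/(X 5) Ea linearZl_LR /= E45 mulr0 => /eqP.
    by rewrite eq_sym oner_eq0.
  apply/eqP => E0; have [_ _] := st (inZp 3) (inZp 3).
  by rewrite eqxx -/(X 4) E0 linear0l => /eqP; rewrite eq_sym oner_eq0.
have fr : free [:: prd x1 y2; prd y1 y2].
  by have := dimvS sub; rewrite d5 /free eqn_leq dim_span => ->.
rewrite {1}E3.
case/memv_addP => [c /memv_addP[d dL [_ /vlineP[s ->] ->]] [_ /vlineP[t ->] ->]].
have y2Z := @Y_Z4 2 isT; have y3Z := @Y_Z4 3 isT.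
rewrite -/x1 -/y1 !linearDl !linearZl_LR /= (kill _ _ dL y2Z) (kill _ _ dL y3Z).
rewrite !add0r => E0.
have [s0 t0] : s = 0 /\ t = 0.
  have := @freeP _ _ _ (in_tuple [:: prd x1 y2; prd y1 y2]) fr.
  move/(_ (fun i => if i == ord0 then s else t)).
  rewrite !big_ord_recl big_ord0 /= addr0 => /(_ E0) H.
  by have := H ord0; have := H (inord 1); rewrite -!val_eqE /= inordK.
by rewrite s0 t0 !scale0r addr0.
Qed.

Lemma tauE (u : L) : u \in lcs L 3 ->
  vsval (tau e (vsproj (lcs L 5) (prd u (e (Y 2))))) = prd u (e (Y 3)).
Proof.
move=> uL; pose phi := mul35 y2.
have mE y w : mul35 y w = vsproj (lcs L 5) (prd (vsval w) y).
  by rewrite /mul35 !comp_lfunE !lfunE.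
have phiE : vsproj (lcs L 5) (prd u y2) = phi (vsproj (lcs L 3) u).
  by rewrite mE vsprojK.
rewrite -/y2 phiE /tau comp_lfunE -/y2 -/y3 -/phi mE.
set w := (phi^-1)%VF _.
have Ew : phi w = phi (vsproj (lcs L 3) u) by rewrite limg_lfunVK ?memv_img ?memvf.
have wL : vsval w \in lcs L 3 := subvsP w.
rewrite vsprojK ?L3_y3 //; apply/eqP; rewrite -subr_eq0 -linearBl; apply/eqP.
apply: ker_y2; first by rewrite memvB.
have := congr1 vsval Ew; rewrite !mE !vsprojK ?L3_y2 // => E.
by rewrite linearBl E subrr.
Qed.
End TypeA.

Section MinimalPolynomial.
Variables (F : fieldType) (V : vectType F).

Definition annihilates (p : {poly F}) (f : 'End(V)) : Prop :=
  forall v, \sum_(i < size p) p`_i *: iter i f v = 0.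

Definition is_minpoly (p : {poly F}) (f : 'End(V)) : Prop :=
  [/\ p \is monic, annihilates p f & forall q, annihilates q f -> p %| q].

End MinimalPolynomial.

Definition type_A (F : fieldType) (L : saa F) : Prop :=
  exists e : bidx -> L,
    [/\ standard_basis e, adapted e
      & exists2 p, is_minpoly p (tau e) &
          exists a b : F, [/\ a != b, root p a & root p b]].

Section Presentations.
Variable F : fieldType.

(* An entry (u, v, w, c) stands for the listed value (uv, w) = c. *)
Definition presentation : Type := seq (bidx * bidx * bidx * F).

Definition has_presentation (L : saa F) (P : presentation) : Prop :=
  exists e : bidx -> L,
    [/\ standard_basis e,
        forall u v w c, (u, v, w, c) \in P -> sform (prd (e u) (e v)) (e w) = c
      & forall u v w,
          (forall u' v' w' c, (u', v', w', c) \in P ->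
             ~~ perm_eq [:: u; v; w] [:: u'; v'; w']) ->
          sform (prd (e u) (e v)) (e w) = 0].

Definition P10_36 (r : F) : presentation :=
  [:: (X 2, Y 4, Y 5, r); (X 1, Y 2, Y 4, 1);
      (Y 1, Y 2, Y 5, 1); (Y 1, Y 3, Y 5, 1)].

End Presentations.

(* The data of P10_36 r do come from an algebra: bidx-indexed coordinates with
   the product read off from the triple values. *)
Section Model.
Variables (F : fieldType) (r : F).
Let V := {ffun bidx -> F^o}.
Implicit Types u v w : V.

Definition model_basis (a : bidx) : V := [ffun c => (c == a)%:R].

Definition model_form u v : F :=
  \sum_(i < 5) (u (inl i) * v (inr i) - u (inr i) * v (inl i)).

Definition wedge (a b c : bidx) (u v w : bidx -> F) : F :=
  u a * (v b * w c - v c * w b) - u b * (v a * w c - v c * w a)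
  + u c * (v a * w b - v b * w a).

Definition model_triple (u v w : bidx -> F) : F :=
  r * wedge (X 2) (Y 4) (Y 5) u v w + wedge (X 1) (Y 2) (Y 4) u v w
  + wedge (Y 1) (Y 2) (Y 5) u v w + wedge (Y 1) (Y 3) (Y 5) u v w.

Definition model_prd u v : V :=
  [ffun a => match a with
             | inl i => model_triple u v (model_basis (inr i))
             | inr i => - model_triple u v (model_basis (inl i))
             end].

Lemma sum_delta w c : \sum_(a : bidx) w a * model_basis a c = w c.
Proof.
rewrite (bigD1 c) //= ffunE eqxx mulr1 big1 ?addr0 // => a /negPf ac.
by rewrite ffunE eq_sym ac mulr0.
Qed.

Lemma wedge_sum a b c u v w :
  \sum_d w d * wedge a b c u v (model_basis d) = wedge a b c u v w.
Proof.
pose K1 := u a * v b - u b * v a.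
pose K2 := u c * v a - u a * v c.
pose K3 := u b * v c - u c * v b.
have E z : wedge a b c u v z = K1 * z c + K2 * z b + K3 * z a.
  by rewrite /wedge /K1 /K2 /K3; ring.
rewrite E -(sum_delta w a) -(sum_delta w b) -(sum_delta w c) !mulr_sumr -!big_split.
by apply: eq_bigr => d _; rewrite E /=; ring.
Qed.

Lemma triple_sum u v w :
  \sum_d w d * model_triple u v (model_basis d) = model_triple u v w.
Proof.
rewrite /model_triple -!wedge_sum mulr_sumr -!big_split /=.
by apply: eq_bigr => d _; ring.
Qed.

Lemma model_form_prd u v w : model_form (model_prd u v) w = model_triple u v w.
Proof.
rewrite -triple_sum big_sumType /= -big_split.
apply: eq_bigr => i _; rewrite !ffunE mulNr opprK addrC [X in X + _]mulrC [X in _ + X]mulrC; done.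
Qed.

Lemma model_form_bilinear : bilinear_for *%R *%R model_form.
Proof.
split=> [v|u] a x y; rewrite /model_form /= mulr_sumr -big_split;
apply: eq_bigr => i _; rewrite !ffunE /= /GRing.scale /=; ring.
Qed.
HB.instance Definition _ :=
  bilinear_isBilinear.Build F V V F *%R *%R model_form model_form_bilinear.

Lemma model_prd_bilinear : bilinear_for *:%R *:%R model_prd.
Proof.
by split=> [v|u] a x y; apply/ffunP => -[i|i];
  rewrite /= !ffunE /= /model_triple /wedge !ffunE /= /GRing.scale /=; ring.
Qed.
HB.instance Definition _ :=
  bilinear_isBilinear.Build F V V V *:%R *:%R model_prd model_prd_bilinear.

Lemma model_formxx u : model_form u u = 0.
Proof. by rewrite /model_form big1 // => i _; rewrite mulrC subrr. Qed.

Lemma model_form_nondeg u : (forall v, model_form u v = 0) -> u = 0.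
Proof.
have dE b c : model_basis b c = (c == b)%:R :> F by rewrite ffunE.
move=> u0; apply/ffunP => -[] i; rewrite ffunE.
  rewrite -(u0 (model_basis (inr i))) /model_form (bigD1 i) //= big1 => [|j ji].
    by rewrite !dE eqxx /= mulr1 mulr0 subr0 addr0.
  have E : (inr j == inr i :> bidx) = (j == i) by [].
  by rewrite !dE E (negPf ji) /= !mulr0 subr0.
apply/eqP; rewrite -oppr_eq0 -(u0 (model_basis (inl i))) /model_form.
rewrite (bigD1 i) //= big1 => [|j ji].
  by rewrite !dE eqxx /= mulr1 mulr0 sub0r addr0.
have E : (inl j == inl i :> bidx) = (j == i) by [].
by rewrite !dE E (negPf ji) /= !mulr0 subr0.
Qed.

Lemma model_prdxx u : model_prd u u = 0.
Proof.
by apply/ffunP => -[] i; rewrite !ffunE /model_triple /wedge !ffunE; ring.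
Qed.

Lemma model_cycle u v w :
  model_form (model_prd u v) w = model_form (model_prd v w) u.
Proof. by rewrite !model_form_prd /model_triple /wedge; ring. Qed.

Definition model : saa F :=
  @Saa F V model_form model_prd model_formxx model_form_nondeg model_prdxx
    model_cycle.

Lemma wedge_delta0 a b c a' b' c' :
  ~~ perm_eq [:: a'; b'; c'] [:: a; b; c] ->
  wedge a b c (model_basis a') (model_basis b') (model_basis c') = 0.
Proof.
move=> np; pose d x y : F := (x == y :> bidx)%:R.
have Z x y z : perm_eq [:: x; y; z] [:: a; b; c] -> d x a' * d y b' * d z c' = 0.
  move=> pxyz; rewrite /d -!natrM !mulnb.
  case: andP => // -[/andP[/eqP xa /eqP yb] /eqP zc].
  by move: np; rewrite -xa -yb -zc pxyz.
have -> : wedge a b c (model_basis a') (model_basis b') (model_basis c') =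
  d a a' * d b b' * d c c' - d a a' * d c b' * d b c'
  - d b a' * d a b' * d c c' + d b a' * d c b' * d a c'
  + d c a' * d a b' * d b c' - d c a' * d b b' * d a c'.
  have dE x y : model_basis y x = d x y :> F by rewrite ffunE.
  rewrite /wedge !dE. ring.
by rewrite !Z ?subr0 ?addr0 //; apply/permP => p /=; lia.
Qed.

Lemma wedge_delta1 a b c : uniq [:: a; b; c] ->
  wedge a b c (model_basis a) (model_basis b) (model_basis c) = 1.
Proof.
rewrite /= !inE andbT negb_or => /andP[/andP[ab ac] bc].
have dE x y : model_basis y x = (x == y)%:R :> F by rewrite ffunE.
rewrite /wedge !dE !eqxx (eq_sym b a) (eq_sym c a) (eq_sym c b).
by rewrite (negPf ab) (negPf ac) (negPf bc) /=; ring.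
Qed.

Lemma model_standard : standard_basis (model_basis : bidx -> model).
Proof.
have dE b c : model_basis b c = (c == b)%:R :> F by rewrite ffunE.
split.
  have sp : span (codom (model_basis : bidx -> model)) = fullv.
    apply/eqP; rewrite eqEsubv subvf /=; apply/subvP => v _.
    have -> : v = \sum_b (v : V) b *: (model_basis b : model).
      apply/ffunP => c; rewrite sum_ffunE -(sum_delta v).
      by apply: eq_bigr => b _; rewrite !ffunE.
    by apply: memv_suml => b _; apply: memvZ; apply: memv_span; apply: codom_f.
  rewrite basisEdim sp subvv /= size_codom card_sum card_ord.
  by rewrite dimvf /dim /= card_sum card_ord.
move=> i j; split.
- by apply: big1 => k _; rewrite !dE /= !mulr0 mul0r subr0.
- by apply: big1 => k _; rewrite !dE /= !mulr0 mul0r subr0.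
rewrite /sform /= /model_form (bigD1 i) //= big1 => [|k ki].
  by rewrite !dE eqxx /= mul1r mul0r subr0 addr0.
have E : (inl k == inl i :> bidx) = (k == i) by [].
by rewrite !dE E (negPf ki) /= !mul0r subr0.
Qed.

Lemma model_has_presentation : has_presentation model (P10_36 r).
Proof.
have TE (u v w : bidx) : sform (prd (model_basis u : model) (model_basis v))
    (model_basis w) =
    model_triple (model_basis u) (model_basis v) (model_basis w).
  exact: model_form_prd.
exists model_basis; split; first exact: model_standard.
  move=> u v w c; rewrite TE /model_triple !inE.
  case/or4P => /eqP[-> -> -> ->]; rewrite wedge_delta1 ?wedge_delta0 ?wedge_delta0 ?wedge_delta0.
  all: lazymatch goal with |- is_true _ => by vm_compute | |- _ = _ => by ring | |- _ => idtac end.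
move=> u v w np; rewrite TE /model_triple !wedge_delta0 ?mulr0 ?addr0 //.
- by apply: (np _ _ _ 1); rewrite !inE eqxx ?orbT.
- by apply: (np _ _ _ 1); rewrite !inE eqxx ?orbT.
- by apply: (np _ _ _ 1); rewrite !inE eqxx ?orbT.
- by apply: (np _ _ _ r); rewrite !inE eqxx ?orbT.
Qed.
End Model.

(* Main.v *)
From HB Require Import structures.
Require Import Defs.
From mathcomp Require Import all_boot all_order all_algebra.
From mathcomp Require Import ring zify.

Set Implicit Arguments.
Unset Strict Implicit.
Unset Printing Implicit Defensive.

Import GRing.Theory.
Local Open Scope ring_scope.

(** The product of a symplectic alternating algebra is the same thing as the
    alternating trilinear form (u, v, w) |-> (uv, w), and a presentation writes
    this 3-form as a sum of decomposable ones in the coordinates of a standard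
    basis (presented_triples, triples_presented). Everything then becomes a
    computation with 3-forms and symplectic changes of basis.

    Existence. In an adapted basis L^3 is spanned by x_1, y_1 modulo L^4, and
    every element of L^5 is u y_2 with u in F x_1 + F y_1. Hence an eigenvector
    of tau for the eigenvalue a is some nonzero u y_2 with u y_3 = a (u y_2).
    The two roots of the minimal polynomial give u and v which, after scaling,
    satisfy (u, v) = 1 (tau_eigenbasis). They are the new x_1 and y_1, and
    u y_2, v y_2 are the new x_4 and x_5; replacing y_3 by a combination of y_2
    and y_3 moves the eigenvalues to 0 and 1 (adapted_presentation). In this
    basis the only triples not yet prescribed involve x_2, x_1, y_1, y_2 or y_3
    with y_4 y_5, or y_2 y_3 with y_4 or y_5. Since (x_2 y_4, y_5) is nonzero,
    x_2 not being central, the terms in y_4 y_5 can be collected into a single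
    decomposable form with a new x_2-coordinate, and the remaining two are
    absorbed in the same way by the x_1- and y_1-coordinates
    (clear_presentation).

    Isomorphism. Rescaling the basis by the weights b, b, b, 1, b^-2 on the x_i
    and their inverses on the y_i multiplies r by b^3 (has_presentation_scaled),
    and a presentation determines the algebra (saa_iso_of_presentation).
    Conversely let two standard bases of one algebra realise r and s. The four
    elements x_1, y_1, x_2, y_2 of the second basis can be written as iterated
    products, so in the first basis they lie in the corresponding terms of the
    lower central series. Let eta be the y_2-coordinate of the second y_2 and xi
    the x_2-coordinate of the second x_2. The pairing gives xi eta = 1. If D is
    the determinant of the (y_4, y_5)-coordinates of the second y_4, y_5, then
    comparing the products x_1 y_2, y_1 y_2 gives eta^2 D = 1, because the
    change of basis in L^3/L^4 has determinant 1, and comparing (x_2 y_4, y_5)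
    gives s = r xi D = r xi^3 (parameters_mod_cubes). *)

(** * The alternating trilinear form *)

Section Triple.
Variables (F : fieldType) (L : saa F).
Implicit Types u v w : L.

Definition triple u v w : F := sform (prd u v) w.

Lemma tripleC u v w : triple u v w = - triple v u w.
Proof. by rewrite /triple prdC linearNl. Qed.

Lemma triple_cyc u v w : triple u v w = triple v w u.
Proof. exact: form_prd. Qed.

Lemma triplexx u w : triple u u w = 0.
Proof. by rewrite /triple prdxx linear0l. Qed.

End Triple.

(** The adjacent swap and the rotation generate all permutations of three
    arguments, so alternation lets a triple be compared with a listed one. *)
Lemma perm3_ind (T : eqType) (Q : T -> T -> T -> Prop) :
  (forall i j k, Q i j k -> Q j i k) -> (forall i j k, Q i j k -> Q j k i) ->
  forall i j k a b c, perm_eq [:: i; j; k] [:: a; b; c] -> Q a b c -> Q i j k.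
Proof.
move=> sw cy i j k a b c.
have single m n : perm_eq [:: m] [:: n] -> m = n.
  by move=> pe; case: (perm_small_eq (erefl : is_true (size [:: n] <= 1)%N) pe).
have Q2 m n : perm_eq [:: j; k] [:: m; n] -> (m = j /\ n = k) \/ (m = k /\ n = j).
  move=> pe; have := perm_mem pe j; rewrite !inE eqxx /= => /esym/orP[]/eqP E; subst j.
    by left; split=> //; move: pe; rewrite perm_cons => /single.
  right; split=> //; have : perm_eq [:: n; k] [:: n; m].
    by apply: perm_trans pe _; apply/permP => p /=; lia.
  by rewrite perm_cons => /single.
move=> pe; have := perm_mem pe i; rewrite !inE eqxx /= => /esym /or3P[]/eqP E; subst i.
- move: pe; rewrite perm_cons => /Q2[[-> ->]|[-> ->]] //.
  by move/cy/sw/cy/cy.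
- have : perm_eq [:: b; j; k] [:: b; a; c].
    by apply: perm_trans pe _; apply/permP => p /=; lia.
  rewrite perm_cons => /Q2[[-> ->]|[-> ->]]; first exact: sw.
  by move/cy.
- have : perm_eq [:: c; j; k] [:: c; a; b].
    by apply: perm_trans pe _; apply/permP => p /=; lia.
  rewrite perm_cons => /Q2[[-> ->]|[-> ->]]; first by move/cy/cy.
  by move/cy/sw.
Qed.

(** Labels are compared through natural numbers so that equality tests between
    explicit labels reduce by simplification. *)
Definition label_code (b : bidx) : nat :=
  match b with inl i => val i | inr i => 5 + val i end.

Lemma model_basisE (F : fieldType) a b :
  model_basis F a b = (label_code b == label_code a)%:R.
Proof.
rewrite ffunE; case: a b => i [] j //=; congr (_%:R).
- by have := ltn_ord i; case: eqP => //; lia.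
- by have := ltn_ord j; case: eqP => //; lia.
Qed.

Definition label_delta (F : fieldType) (a b : bidx) : F :=
  (label_code b == label_code a)%:R.

Lemma model_triple_basis (F : fieldType) (r : F) a b c :
  model_triple r (model_basis F a) (model_basis F b) (model_basis F c) =
  model_triple r (label_delta F a) (label_delta F b) (label_delta F c).
Proof. by rewrite /model_triple /wedge !model_basisE. Qed.

Lemma model_formE (F : fieldType) (u v : {ffun bidx -> F}) : model_form u v =
  \sum_(i < 5) (u (X i.+1) * v (Y i.+1) - u (Y i.+1) * v (X i.+1)).
Proof.
apply: eq_bigr => i _.
have -> : X i.+1 = inl i by congr inl; apply: val_inj; rewrite /= modn_small.
by have -> : Y i.+1 = inr i by congr inr; apply: val_inj; rewrite /= modn_small.
Qed.

(** * Standard bases and coordinates *)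

Section Coordinates.
Variables (F : fieldType) (L : saa F) (e : bidx -> L).

Definition symplectic : Prop := forall i j : 'I_5,
  [/\ sform (e (inl i)) (e (inl j)) = 0,
      sform (e (inr i)) (e (inr j)) = 0
    & sform (e (inl i)) (e (inr j)) = (i == j)%:R].

Lemma sformXX (i j : nat) : symplectic -> sform (e (X i)) (e (X j)) = 0.
Proof. by move=> se; case: (se (inZp i.-1) (inZp j.-1)). Qed.

Lemma sformYY (i j : nat) : symplectic -> sform (e (Y i)) (e (Y j)) = 0.
Proof. by move=> se; case: (se (inZp i.-1) (inZp j.-1)). Qed.

Lemma sformXY (i j : nat) : symplectic ->
  sform (e (X i)) (e (Y j)) = (i.-1 %% 5 == j.-1 %% 5)%N%:R.
Proof. by move=> se; case: (se (inZp i.-1) (inZp j.-1)). Qed.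

Lemma sformYX (i j : nat) : symplectic ->
  sform (e (Y i)) (e (X j)) = - (i.-1 %% 5 == j.-1 %% 5)%N%:R.
Proof. by move=> se; rewrite sformC sformXY // eq_sym. Qed.

(** Rewriting rule evaluating the form on explicit elements of the basis. *)
Definition sformJ (se : symplectic) :=
  (fun i j => sformXX i j se, fun i j => sformYY i j se,
   fun i j => sformXY i j se, fun i j => sformYX i j se).

(** Duality makes y_i, respectively x_i, read off the coordinate of x_i,
    respectively y_i; thus coordinates make sense for any family e, even before
    it is known to be a basis. *)
Definition coords (u : L) : {ffun bidx -> F} :=
  [ffun b => match b with
             | inl i => sform u (e (inr i))
             | inr i => sform (e (inl i)) u
             end].

Hypothesis se : symplectic.

Lemma coords_basis b : coords (e b) = model_basis F b.
Proof.
apply/ffunP => c; rewrite !ffunE.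
case: b c => i [] j; case: (se i j) (se j i) => E1 E2 E3 [E4 E5 E6].
- by rewrite E3 eq_sym.
- by rewrite E4.
- by rewrite E2.
- by rewrite E6.
Qed.

Lemma coords_sum (k : bidx -> F) c :
  coords (\sum_b k b *: e b) c = k c.
Proof.
have -> : coords (\sum_b k b *: e b) c = \sum_b k b * coords (e b) c.
  case: c => i; rewrite ffunE ?linear_sumr ?linear_sumlz;
  by apply: eq_bigr => b _; rewrite ffunE ?linearZl_LR ?linearZr_LR.
rewrite (bigD1 c) //= coords_basis ffunE eqxx mulr1 big1 ?addr0 // => b /negPf bc.
by rewrite coords_basis ffunE eq_sym bc mulr0.
Qed.

(** Pairing a linear relation with the dual element isolates each coefficient,
    so the symplectic relations alone force independence; in dimension 10 only
    these relations need to be checked of a new basis. *)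
Lemma symplectic_free : free (codom e).
Proof.
rewrite -[codom e]in_tupleE; apply/freeP => k k0 i.
have sz : size (codom e) = #|{: bidx}| by rewrite size_codom.
pose k' b := k (cast_ord (esym sz) (enum_rank b)).
have E : \sum_b k' b *: e b = 0.
  rewrite -[RHS]k0 (reindex (fun j => enum_val (cast_ord sz j))) /=; last first.
    exists (fun b => cast_ord (esym sz) (enum_rank b)) => x _;
    by rewrite ?enum_valK ?cast_ordK ?cast_ordKV ?enum_rankK.
  apply: eq_bigr => j _; rewrite /k' enum_valK cast_ordK; congr (_ *: _).
  rewrite (nth_map (enum_val (cast_ord sz j))) -?cardE -?sz //.
  by congr (e _); apply: enum_val_nth.
have := coords_sum k' (enum_val (cast_ord sz i)).
rewrite E /k' enum_valK cast_ordK => <-.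
by case: (enum_val _) => j; rewrite ffunE ?linear0l ?linear0r.
Qed.

Lemma standard_of_dim : \dim (fullv : {vspace L}) = 10%N -> standard_basis e.
Proof.
move=> d10; split=> //; rewrite basisEfree symplectic_free subvf /= d10.
by rewrite size_codom card_sum !card_ord.
Qed.

End Coordinates.

Section Standard.
Variables (F : fieldType) (L : saa F) (e : bidx -> L).
Hypothesis st : standard_basis e.
Let se : symplectic e := proj2 st.

Lemma standard_dim : \dim (fullv : {vspace L}) = 10%N.
Proof.
case: st => bs _; rewrite -(span_basis bs) (eqP (basis_free bs)).
by rewrite size_codom card_sum !card_ord.
Qed.

Lemma coordsE u : u = \sum_b coords e u b *: e b.
Proof.
apply/eqP; rewrite -subr_eq0; apply/eqP; apply: (orth0 st) => b.
rewrite linearBl /=.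
set v := \sum_b _.
have E c : coords e v c = coords e u c by rewrite coords_sum.
case: b => i.
  have := E (inr i); rewrite !ffunE => {}E.
  by rewrite sformC [sform v _]sformC E subrr.
by have := E (inl i); rewrite !ffunE => ->; rewrite subrr.
Qed.

Lemma sform_coords u v : sform u v = model_form (coords e u) (coords e v).
Proof.
rewrite {1}(coordsE v) linear_sumr /model_form big_sumType /= -big_split /=.
apply: eq_bigr => i _; rewrite !linearZr_LR /= !ffunE.
rewrite [sform u (e (inl i))]sformC mulrN addrC mulrC; congr (_ - _).
exact: mulrC.
Qed.

End Standard.

(** * Presentations as trilinear forms *)

Section Wedge.
Variable F : fieldType.
Implicit Types (P : presentation F) (u v w : {ffun bidx -> F}).

Definition presentation_form P u v w : F :=
  \sum_(p <- P) p.2 * wedge (F := F) p.1.1.1 p.1.1.2 p.1.2 u v w.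

(** No entry of the presentation is zero by alternation or determined by
    another entry; otherwise the sum of the wedges could count a value
    twice. *)
Definition reduced P : bool :=
  all (fun p => uniq [:: p.1.1.1; p.1.1.2; p.1.2]) P &&
  pairwise (fun p q => ~~ perm_eq [:: p.1.1.1; p.1.1.2; p.1.2]
                                  [:: q.1.1.1; q.1.1.2; q.1.2]) P.

Lemma presentation_formC P u v w : presentation_form P u v w = - presentation_form P v u w.
Proof. by rewrite /presentation_form -sumrN; apply: eq_bigr => p _; rewrite /wedge; ring. Qed.

Lemma presentation_form_cyc P u v w : presentation_form P u v w = presentation_form P v w u.
Proof. by apply: eq_bigr => p _; rewrite /wedge; ring. Qed.

Lemma presentation_form_expand P u v w :
  presentation_form P u v w = \sum_d w d * presentation_form P u v (model_basis F d).
Proof.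
under [RHS]eq_bigr do rewrite mulr_sumr.
rewrite exchange_big; apply: eq_bigr => p _ /=.
rewrite -wedge_sum mulr_sumr; apply: eq_bigr => d _.
by rewrite mulrCA.
Qed.

Lemma presentation_form_unlisted P a b c :
  (forall p, p \in P -> ~~ perm_eq [:: a; b; c] [:: p.1.1.1; p.1.1.2; p.1.2]) ->
  presentation_form P (model_basis F a) (model_basis F b) (model_basis F c) = 0.
Proof.
move=> np; rewrite /presentation_form big_seq big1 // => p /np.
by move/wedge_delta0 ->; rewrite mulr0.
Qed.

Lemma presentation_form_listed P p : reduced P -> p \in P ->
  presentation_form P (model_basis F p.1.1.1) (model_basis F p.1.1.2)
    (model_basis F p.1.2) = p.2.
Proof.
rewrite /reduced; elim: P => //= q P IH /andP[/andP[uq uP] /andP[/allP qP pP]].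
rewrite inE /presentation_form big_cons; case: (eqVneq p q) => [-> _|_ /= pin].
  rewrite (wedge_delta1 F uq) mulr1 -/(presentation_form P _ _ _).
  by rewrite presentation_form_unlisted ?addr0.
rewrite wedge_delta0 1?perm_sym ?qP // mulr0 add0r.
by apply: IH => //; rewrite uP.
Qed.

End Wedge.

Section Presented.
Variables (F : fieldType) (L : saa F) (e : bidx -> L) (P : presentation F).

Definition presented : Prop :=
  (forall u v w c, (u, v, w, c) \in P -> triple (e u) (e v) (e w) = c) /\
  (forall u v w,
    (forall u' v' w' c, (u', v', w', c) \in P ->
       ~~ perm_eq [:: u; v; w] [:: u'; v'; w']) ->
    triple (e u) (e v) (e w) = 0).

Definition has_triples : Prop := forall u v w,
  triple u v w = presentation_form P (coords e u) (coords e v) (coords e w).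

(** Both sides are alternating and trilinear, so it is enough to compare them on
    the basis, where a listed triple may occur in any order. *)
Lemma presented_triples : standard_basis e -> reduced P -> presented ->
  has_triples.
Proof.
move=> st red [on off]; have se := proj2 st.
pose E u v w := triple u v w = presentation_form P (coords e u) (coords e v) (coords e w).
have cyc u v w : E u v w -> E v w u.
  by rewrite /E => Euvw; rewrite -triple_cyc Euvw presentation_form_cyc.
have step u v : (forall d, E u v (e d)) -> forall w, E u v w.
  move=> Ed w; rewrite /E {1}(coordsE st w) /triple linear_sumr presentation_form_expand.
  apply: eq_bigr => d _; rewrite linearZr_LR /= -/(triple _ _ _) Ed.
  by rewrite coords_basis.
suff base i j k : E (e i) (e j) (e k).
  move=> u v; apply: (step) => k; apply: (cyc); move: v.
  apply: (step) => j; apply: (cyc); move: u.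
  by apply: (step) => i; apply: base.
rewrite /E !coords_basis //.
have [/hasP[[[[a b] c] x] pin /= pe]|np] :=
    boolP (has (fun p => perm_eq [:: i; j; k] [:: p.1.1.1; p.1.1.2; p.1.2]) P).
  pose Q i j k := triple (e i) (e j) (e k) =
    presentation_form P (model_basis F i) (model_basis F j) (model_basis F k).
  apply: (@perm3_ind _ Q _ _ _ _ _ _ _ _ pe).
  - by move=> l m n E0; rewrite /Q tripleC E0 -presentation_formC.
  - by move=> l m n E0; rewrite /Q -triple_cyc E0 presentation_form_cyc.
  rewrite /Q (on _ _ _ _ pin).
  by have := presentation_form_listed red pin.
rewrite off => [|a b c x pin].
  rewrite presentation_form_unlisted // => p pin.
  by apply: contra np => pe; apply/hasP; exists p.
by apply: contra np => pe; apply/hasP; exists (a, b, c, x).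
Qed.

Lemma triples_presented : symplectic e -> reduced P -> has_triples -> presented.
Proof.
move=> se red E; split=> [u v w c pin|u v w np]; rewrite E !coords_basis //.
  exact: (presentation_form_listed red pin).
by apply: presentation_form_unlisted => -[[[a b] c] x] /np.
Qed.

End Presented.

(** Identify elements with equal coordinates: the form and the 3-form have the
    same expression in both algebras, and they determine the product. *)
Lemma saa_iso_of_presentation (F : fieldType) (L M : saa F) (P : presentation F) :
  reduced P -> has_presentation L P -> has_presentation M P -> saa_iso L M.
Proof.
move=> red [e [st on off]] [e' [st' on' off']].
have TL : has_triples e P by apply: presented_triples.
have TM : has_triples e' P by apply: presented_triples.
have [se se'] := (proj2 st, proj2 st').
pose f (u : L) : M := \sum_b coords e u b *: e' b.
pose g (u : M) : L := \sum_b coords e' u b *: e b.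
have flin : linear f.
  move=> k u v; rewrite /f scaler_sumr -big_split; apply: eq_bigr => b _ /=.
  rewrite scalerA -scalerDl; congr (_ *: _).
  by case: b => i; rewrite !ffunE ?linearDl ?linearDr ?linearZl_LR ?linearZr_LR.
have cf u : coords e' (f u) = coords e u.
  by apply/ffunP => b; rewrite coords_sum.
have cg u : coords e (g u) = coords e' u.
  by apply/ffunP => b; rewrite coords_sum.
have fK : cancel f g.
  by move=> u; rewrite /g; under eq_bigr do rewrite cf; rewrite -coordsE.
have gK : cancel g f.
  by move=> u; rewrite /f; under eq_bigr do rewrite cg; rewrite -coordsE.
pose lf : {linear L -> M} := HB.pack f (GRing.isLinear.Build _ _ _ _ f flin).
have fform u v : sform (f u) (f v) = sform u v.
  by rewrite (sform_coords st') !cf -sform_coords.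
exists lf; split=> [|u v|u v] /=.
- by exists g.
- exact: fform.
apply/eqP; rewrite -subr_eq0; apply/eqP; apply: form_nondeg => w.
rewrite linearBl /= -(gK w) fform -/(triple _ _ _) -/(triple (f u) _ _) TL TM.
by rewrite !cf subrr.
Qed.

(** * Parameters of the same algebra differ by a cube *)

Lemma P10_36_reduced (F : fieldType) (r : F) : reduced (P10_36 r).
Proof. by []. Qed.

(** Scaling x_i by t_i and y_i by 1/t_i keeps the values 1 exactly when
    t_1 = t_2 t_4, t_3 = t_2 and t_1 t_2 t_5 = 1; then (x_2 y_4, y_5) is
    multiplied by t_2 / (t_4 t_5) = t_2^3. *)
Lemma has_presentation_scaled (F : fieldType) (L : saa F) (r b : F) :
  b != 0 -> has_presentation L (P10_36 r) ->
  has_presentation L (P10_36 (r * b ^+ 3)).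
Proof.
move=> b0 [e [st on off]].
pose t (i : 'I_5) : F := nth 0 [:: b; b; b; 1; b ^- 2] i.
have t0 i : t i != 0.
  by case: i => [[|[|[|[|[|i]]]]] Hi] //; rewrite /t /= ?oner_neq0 // invr_neq0 ?expf_neq0.
pose c (a : bidx) : F := match a with inl i => t i | inr i => (t i)^-1 end.
pose e' a := c a *: e a.
have T' u v w : sform (prd (e' u) (e' v)) (e' w) =
    c u * c v * c w * sform (prd (e u) (e v)) (e w).
  by rewrite /e' !(linearZl_LR, linearZr_LR) /=; ring.
exists e'; split.
- apply: standard_of_dim (standard_dim st) => i j.
  rewrite /e' !linearZl_LR !linearZr_LR /=; have [-> -> ->] := (proj2 st) i j.
  rewrite !mulr0; split=> //; case: eqVneq => [->|_]; last by rewrite !mulr0.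
  by rewrite mulr1 mulfV.
- move=> u v w d; rewrite T' !inE => /or4P[]/eqP[-> -> -> ->].
  + by rewrite (on _ _ _ r) ?inE ?eqxx // /c /t /=; field; rewrite ?b0 ?oner_neq0.
  + by rewrite (on _ _ _ 1) ?inE ?eqxx ?orbT // /c /t /=; field; rewrite ?b0 ?oner_neq0.
  + by rewrite (on _ _ _ 1) ?inE ?eqxx ?orbT // /c /t /=; field; rewrite ?b0 ?oner_neq0.
  + by rewrite (on _ _ _ 1) ?inE ?eqxx ?orbT // /c /t /=; field; rewrite ?b0 ?oner_neq0.
move=> u v w np; rewrite T' off ?mulr0 // => u' v' w' d.
rewrite !inE => /or4P[]/eqP[-> -> -> _].
- by apply: (np _ _ _ (r * b ^+ 3)); rewrite !inE eqxx ?orbT.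
- by apply: (np _ _ _ 1); rewrite !inE eqxx ?orbT.
- by apply: (np _ _ _ 1); rewrite !inE eqxx ?orbT.
- by apply: (np _ _ _ 1); rewrite !inE eqxx ?orbT.
Qed.

Section Products.
Variables (F : fieldType) (L : saa F) (e : bidx -> L) (r : F).
Hypothesis se : symplectic e.
Hypothesis T : has_triples e (P10_36 r).

Lemma P10_36_tripleE u v w : triple u v w =
  model_triple r (coords e u) (coords e v) (coords e w).
Proof.
rewrite T /presentation_form !big_cons big_nil /= /model_triple !mul1r addr0.
by rewrite !addrA.
Qed.

Lemma coords_prdX u v i : coords e (prd u v) (X i) = triple u v (e (Y i)).
Proof. by rewrite ffunE. Qed.

Lemma coords_prdY u v i : coords e (prd u v) (Y i) = - triple u v (e (X i)).
Proof. by rewrite ffunE /= sformC. Qed.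

(** In a basis realising the presentation with r nonzero, this condition for
    k = 3 defines L^2 and for k = 2 defines L^3; for k = 1, together with the
    vanishing of the coordinate of x_1, it defines L^4. *)
Definition Y_vanish_from k u := forall i, (k <= i <= 5)%N -> coords e u (Y i) = 0.

(* A coordinate of a product is a triple with an explicit third argument, hence
   a bilinear expression in the coordinates of the factors. *)
Ltac compute_coord := rewrite ?coords_prdX ?coords_prdY P10_36_tripleE
  coords_basis // /model_triple /wedge !model_basisE /=.

(** The elements x_3, x_4, x_5 are central, so they are orthogonal to L^2. *)
Lemma prd_Y_vanish3 u v : Y_vanish_from 3 (prd u v).
Proof.
by move=> [|[|[|[|[|[|i]]]]]] // _; compute_coord; ring.
Qed.

(** The coordinate of y_2 in u v is -(u v, x_2), which is a multiple of the
    y_4 y_5 minor of u and v. *)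
Lemma prd_Y_vanish2 u v : Y_vanish_from 3 u -> Y_vanish_from 2 (prd u v).
Proof.
move=> u3 [|[|[|i]]] // Hi; last exact: prd_Y_vanish3.
by compute_coord; rewrite (u3 3) // (u3 4) // (u3 5) //; ring.
Qed.

(** Every term of the 3-form that contains x_1 or y_1 also contains two of
    y_2, ..., y_5. *)
Lemma prd_Y_vanish1 u v : Y_vanish_from 2 u ->
  Y_vanish_from 1 (prd u v) /\ coords e (prd u v) (X 1) = 0.
Proof.
move=> u2; split; last first.
  by compute_coord; rewrite (u2 2) // (u2 3) // (u2 4) // (u2 5) //; ring.
have u3 : Y_vanish_from 3 u by move=> i Hi; apply: u2; lia.
move=> [|[|i]] // Hi; last by apply: prd_Y_vanish2.
by compute_coord; rewrite (u2 2) // (u2 3) // (u2 4) // (u2 5) //; ring.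
Qed.

End Products.

Lemma Y_vanish_fromZ (F : fieldType) (L : saa F) (e : bidx -> L) k u (a : F) :
  Y_vanish_from e k u -> Y_vanish_from e k (a *: u).
Proof. by move=> uk i /uk; rewrite !ffunE /= linearZr_LR /= => ->; rewrite mulr0. Qed.

(** Primed vectors of the second basis are expanded in the first one; the central
    series leaves so few coordinates that the listed values become the equations
    below. The ratio of the parameters is the cube of xi, the coordinate of the
    new x_2 along the old x_2. *)
Lemma parameters_mod_cubes (F : fieldType) (L : saa F) (r s : F) :
  r != 0 -> s != 0 ->
  has_presentation L (P10_36 r) -> has_presentation L (P10_36 s) ->
  exists b : F, b != 0 /\ s / r = b ^+ 3.
Proof.
move=> r0 s0 [e [st on off]] [e' [st' on' off']].
have [se se'] := (proj2 st, proj2 st').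
have T : has_triples e (P10_36 r) by apply: presented_triples.
have T' : has_triples e' (P10_36 s) by apply: presented_triples.
have prdE u v z : (forall d, triple u v (e' d) = sform z (e' d)) -> prd u v = z.
  move=> E; apply/eqP; rewrite -subr_eq0; apply/eqP; apply: (orth0 st') => d.
  by rewrite linearBl /= -/(triple _ _ _) E subrr.
(* These products express y_2, x_1, y_1, x_2 through iterated products. *)
have [E45 E25 E24 E14] : [/\ prd (e' (Y 4)) (e' (Y 5)) = - s *: e' (Y 2),
    prd (e' (Y 2)) (e' (Y 5)) = e' (X 1),
    prd (e' (Y 2)) (e' (Y 4)) = -1 *: e' (Y 1)
  & prd (e' (X 1)) (e' (Y 4)) = -1 *: e' (X 2)].
  split; apply: prdE; apply: bidxP => -[|[|[|[|[|[|k]]]]]] // _;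
  rewrite (P10_36_tripleE T') !coords_basis // model_triple_basis;
  rewrite /model_triple /wedge /label_delta ?linearZl_LR /= ?(sformJ se') /=; ring.
have y2 : Y_vanish_from e 3 (e' (Y 2)).
  have -> : e' (Y 2) = - s^-1 *: prd (e' (Y 4)) (e' (Y 5)).
    by rewrite E45 scalerA mulrNN mulVf // scale1r.
  by apply: Y_vanish_fromZ; apply: prd_Y_vanish3.
have x1 : Y_vanish_from e 2 (e' (X 1)) by rewrite -E25; apply: prd_Y_vanish2.
have y1 : Y_vanish_from e 2 (e' (Y 1)).
  have -> : e' (Y 1) = -1 *: prd (e' (Y 2)) (e' (Y 4)).
    by rewrite E24 scalerA mulrNN mulr1 scale1r.
  by apply: Y_vanish_fromZ; apply: prd_Y_vanish2.
have [x2 x21] : Y_vanish_from e 1 (e' (X 2)) /\ coords e (e' (X 2)) (X 1) = 0.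
  have -> : e' (X 2) = -1 *: prd (e' (X 1)) (e' (Y 4)).
    by rewrite E14 scalerA mulrNN mulr1 scale1r.
  have [z1 z2] := prd_Y_vanish1 se T (e' (Y 4)) x1; split; first exact: Y_vanish_fromZ.
  by move: z2; rewrite !ffunE /= linearZl_LR /= => ->; rewrite mulr0.
have H0 : sform (e' (X 1)) (e' (Y 1)) = 1 by rewrite (sformJ se').
have H1 : sform (e' (X 2)) (e' (Y 2)) = 1 by rewrite (sformJ se').
have M a b c : model_triple r (coords e (e' a)) (coords e (e' b)) (coords e (e' c)) =
    model_triple s (label_delta F a) (label_delta F b) (label_delta F c).
  by rewrite -(P10_36_tripleE T) (P10_36_tripleE T') !coords_basis // model_triple_basis.
have T11 := M (X 1) (Y 2) (Y 4).
have T12 := M (X 1) (Y 2) (Y 5).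
have T21 := M (Y 1) (Y 2) (Y 4).
have T22 := M (Y 1) (Y 2) (Y 5).
have Ts := M (X 2) (Y 4) (Y 5).
move: H0 H1 T11 T12 T21 T22 Ts {M}.
rewrite !(sform_coords st) !model_formE !big_ord_recl !big_ord0 /= /bump /=.
rewrite /model_triple /wedge /label_delta /=.
rewrite (x1 2) // (x1 3) // (x1 4) // (x1 5) // (y1 2) // (y1 3) // (y1 4) // (y1 5) //.
rewrite (y2 3) // (y2 4) // (y2 5) // (x2 1) // (x2 2) // (x2 3) // (x2 4) // (x2 5) // x21.
set p := coords e (e' (X 1)) (X 1); set q := coords e (e' (X 1)) (Y 1).
set p' := coords e (e' (Y 1)) (X 1); set q' := coords e (e' (Y 1)) (Y 1).
set xi := coords e (e' (X 2)) (X 2); set eta := coords e (e' (Y 2)) (Y 2).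
set a4 := coords e (e' (Y 4)) (Y 4); set a5 := coords e (e' (Y 4)) (Y 5).
set b4 := coords e (e' (Y 5)) (Y 4); set b5 := coords e (e' (Y 5)) (Y 5).
rewrite !(mulr0, mul0r, subr0, addr0, add0r, sub0r, mulr1, mul1r, oppr0) => H0 H1.
have xi0 : xi != 0 by apply: contra_eq_neq H1 => ->; rewrite mul0r eq_sym oner_neq0.
move=> T11 T12 T21 T22 Ts.
(* The matrices of x_1 y_2, y_1 y_2 against y_4, y_5 and of the change of basis
   in L^3/L^4 both have determinant 1. *)
have D : eta ^+ 2 * (a4 * b5 - a5 * b4) = 1.
  transitivity ((p * (eta * a4) + q * (eta * a5)) * (p' * (eta * b4) + q' * (eta * b5))
     - (p * (eta * b4) + q * (eta * b5)) * (p' * (eta * a4) + q' * (eta * a5))).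
    by rewrite -[LHS]mul1r -H0; ring.
  by rewrite T11 T12 T21 T22; ring.
exists xi; split=> //; rewrite -Ts mulrAC mulfV // mul1r.
transitivity (xi * (a4 * b5 - a5 * b4) * (xi * eta) ^+ 2).
  by rewrite H1 expr1n mulr1.
by rewrite -[RHS]mulr1 -D; ring.
Qed.

Lemma saa_iso_has_presentation (F : fieldType) (L M : saa F) (P : presentation F) :
  saa_iso L M -> has_presentation L P -> has_presentation M P.
Proof.
move=> [f [[g fK gK] fform fprd]] [e [st on off]].
have E u v w : sform (prd (f (e u)) (f (e v))) (f (e w)) = sform (prd (e u) (e v)) (e w).
  by rewrite -fprd fform.
exists (fun b => f (e b)); split=> [|u v w c /on <-|u v w /off <-] //.
have sfe : symplectic (fun b => f (e b)).
  by move=> i j; rewrite !fform; apply: (proj2 st).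
split=> //; rewrite basisEfree symplectic_free // subvf /= size_codom.
rewrite card_sum !card_ord -[(5 + 5)%N]/10%N -(standard_dim st).
have -> : (fullv : {vspace M}) = (linfun f @: fullv)%VS.
  apply/eqP; rewrite eqEsubv subvf andbT; apply/subvP => v _.
  by rewrite -(gK v) -(lfunE f); apply: memv_img; apply: memvf.
by rewrite -(limg_ker_dim (linfun f) fullv) leq_addl.
Qed.

(** * Clearing the remaining triples *)

Definition basis_of_seqs (F : fieldType) (L : saa F) (xs ys : seq L) (b : bidx) : L :=
  match b with inl i => xs`_i | inr i => ys`_i end.

(** By alternation only pairs i < j matter for the two isotropic halves. *)
Lemma symplecticP (F : fieldType) (L : saa F) (e : bidx -> L) :
  (forall i j, (0 < i <= 5)%N -> (0 < j <= 5)%N ->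
   [/\ (i < j)%N -> sform (e (X i)) (e (X j)) = 0,
       (i < j)%N -> sform (e (Y i)) (e (Y j)) = 0
     & sform (e (X i)) (e (Y j)) = (i == j)%:R]) -> symplectic e.
Proof.
move=> H i j.
have iE (k : 'I_5) : k = inZp k.+1.-1 by apply: val_inj; rewrite /= modn_small.
have -> : inl i = X i.+1 :> bidx by rewrite {1}(iE i).
have -> : inr i = Y i.+1 :> bidx by rewrite {1}(iE i).
have -> : inl j = X j.+1 :> bidx by rewrite {1}(iE j).
have -> : inr j = Y j.+1 :> bidx by rewrite {1}(iE j).
have [Hi Hj] : (0 < i.+1 <= 5)%N /\ (0 < j.+1 <= 5)%N by split; exact: ltn_ord.
have [XX YY XY] := H _ _ Hi Hj; have [XX' YY' _] := H _ _ Hj Hi.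
split; last by rewrite XY.
  have [/XX //|/XX' E|E] := ltngtP i.+1 j.+1; last by rewrite E formxx.
  by rewrite sformC E oppr0.
have [/YY //|/YY' E|E] := ltngtP i.+1 j.+1; last by rewrite E formxx.
by rewrite sformC E oppr0.
Qed.

(** The shape reached once tau has been diagonalised: six further triples may
    still be nonzero. *)
Definition P10_36_ext (F : fieldType) (r a b c1 c2 c3 c4 : F) : presentation F :=
  P10_36 r ++
  [:: (X 1, Y 4, Y 5, a); (Y 1, Y 4, Y 5, b); (Y 2, Y 3, Y 4, c1);
      (Y 2, Y 3, Y 5, c2); (Y 2, Y 4, Y 5, c3); (Y 3, Y 4, Y 5, c4)].

(** Let p_i, q_i be the coordinate functions of x_i, y_i. The terms containing
    q_4 q_5 add up to r P_2 q_4 q_5 with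
    P_2 = p_2 + (a p_1 + b q_1 + c3 q_2 + c4 q_3) / r. Moreover
    p_1 q_2 q_4 + c1 q_2 q_3 q_4 = P_1 q_2 q_4 and
    q_1 (q_2 + q_3) q_5 + c2 q_2 q_3 q_5 = Q_1 (q_2 + q_3) q_5, where P_1 is
    p_1 - c1 q_3 up to a multiple of q_2, and Q_1 is q_1 - c2 q_3 up to a
    multiple of q_2 + q_3. These two multiples are determined by requiring the
    vectors that represent P_1 and Q_1 to be orthogonal to the one that
    represents P_2. *)
Lemma clear_presentation (F : fieldType) (L : saa F) (r a b c1 c2 c3 c4 : F) :
  r != 0 -> has_presentation L (P10_36_ext r a b c1 c2 c3 c4) ->
  has_presentation L (P10_36 r).
Proof.
move=> r0 [e [st on off]]; have se := proj2 st.
have T : has_triples e (P10_36_ext r a b c1 c2 c3 c4) by apply: presented_triples.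
(* The new y_2, y_1, x_1 represent the coordinate functions P_2, P_1, Q_1;
   the coefficients of y_3 restore its orthogonality to x_1, y_1 and y_2. *)
pose al := c2 + a / r; pose ga := - (a / r * c1 + b / r * al + c4 / r).
pose e' := basis_of_seqs
  [:: e (X 1) - (a / r) *: e (X 2) - (a / r + c2) *: e (X 3);
      e (X 2); e (X 3); e (X 4); e (X 5)]
  [:: e (Y 1) + c1 *: e (X 3) - (b / r) *: e (X 2);
      e (Y 2) + (a / r) *: e (Y 1) - (b / r) *: e (X 1) - (c3 / r) *: e (X 2)
        - (c4 / r) *: e (X 3);
      e (Y 3) + al *: e (Y 1) + c1 *: e (X 1) + ga *: e (X 2); e (Y 4); e (Y 5)].
have se' : symplectic e'.
  apply: symplecticP => -[|[|[|[|[|[|i]]]]]] // [|[|[|[|[|[|j]]]]]] // _ _;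
  split; first [done | move=> _ | idtac]; rewrite /e' /=;
  rewrite ?(linearDl, linearNl, linearZl_LR) /=;
  rewrite ?(linearDr, linearNr, linearZr_LR) /= ?(sformJ se) /= /ga /al;
  by [|field; rewrite ?r0].
have T' : has_triples e' (P10_36 r).
  have cX u k : coords e u (X k) = sform u (e (Y k)) by rewrite ffunE.
  have cY u k : coords e u (Y k) = - sform u (e (X k)) by rewrite ffunE /= sformC.
  have CX1 u : coords e' u (X 1) =
      coords e u (X 1) - c1 * coords e u (Y 3) + b / r * coords e u (Y 2).
    rewrite ffunE /e' /= !cX !cY.
    by rewrite !(linearDr, linearNr, linearZr_LR) /=; ring.
  have CX2 u : coords e' u (X 2) =
      coords e u (X 2) + a / r * coords e u (X 1) + b / r * coords e u (Y 1)
      + c3 / r * coords e u (Y 2) + c4 / r * coords e u (Y 3).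
    rewrite ffunE /e' /= !cX !cY.
    by rewrite !(linearDr, linearNr, linearZr_LR) /=; ring.
  have CY1 u : coords e' u (Y 1) =
      coords e u (Y 1) - a / r * coords e u (Y 2) - (a / r + c2) * coords e u (Y 3).
    rewrite ffunE /e' /= sformC !cY.
    by rewrite !(linearDr, linearNr, linearZr_LR) /=; ring.
  have CY k u : (1 < k <= 5)%N -> coords e' u (Y k) = coords e u (Y k).
    by move: k => [|[|[|[|[|[|k]]]]]] // _; rewrite !ffunE.
  move=> u v w; rewrite T /presentation_form !big_cons !big_nil /= /wedge.
  rewrite !CX1 !CX2 !CY1 !(CY 2) // !(CY 3) // !(CY 4) // !(CY 5) //.
  by field.
have [on' off'] := triples_presented se' (P10_36_reduced r) T'.
by exists e'; split=> //; apply: standard_of_dim (standard_dim st).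
Qed.

(** The labels are ordered so that in a sorted triple of an algebra as in
    ext_presentation the first two elements already have a known product unless
    the triple is listed. *)
Definition vanishing_order : seq bidx :=
  [:: X 3; X 4; X 5; X 2; X 1; Y 1; Y 2; Y 3; Y 4; Y 5].

Lemma alternating_ind (Q : bidx -> bidx -> bidx -> Prop) :
  (forall i j k, Q i j k -> Q j i k) -> (forall i j k, Q i j k -> Q j k i) ->
  (forall i k, Q i i k) ->
  (forall m n p, (m < n < p)%N -> (p < 10)%N ->
     Q (nth (X 1) vanishing_order m) (nth (X 1) vanishing_order n)
       (nth (X 1) vanishing_order p)) ->
  forall i j k, Q i j k.
Proof.
move=> sw cy diag sorted i j k.
pose x m := nth (X 1) vanishing_order m.
have lab b : exists2 m, (m < 10)%N & b = x m.
  exists (index b vanishing_order); last first.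
    rewrite /x nth_index //; move: b.
    by apply: bidxP => -[|[|[|[|[|[|l]]]]]].
  rewrite -[10%N]/(size vanishing_order) index_mem; move: b.
  by apply: bidxP => -[|[|[|[|[|[|l]]]]]].
have [[m Hm ->] [n Hn ->] [p Hp ->]] := And3 (lab i) (lab j) (lab k).
have diag' a b : Q a b b by apply: (cy); apply: (cy); apply: diag.
have diag'' a b : Q a b a by apply: (cy); apply: diag.
have S m' n' p' : (m' < n')%N -> (n' < p')%N -> (p' < 10)%N ->
  Q (x m') (x n') (x p') by move=> mn np; apply: sorted; rewrite mn.
have [mn|nm|->//] := ltngtP m n; have [np|pn|->//] := ltngtP n p;
  have [mp|pm|->//] := ltngtP m p; try (by exfalso; lia).
- exact: S.
- by apply: (cy); apply: (sw); apply: S.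
- by apply: (cy); apply: S.
- by apply: (sw); apply: S.
- by apply: (cy); apply: (cy); apply: S.
- by apply: (sw); apply: (cy); apply: S.
Qed.

(** A triple in which no two members have one of the given products is a listed
    one, and its value is then a parameter of the presentation. *)
Lemma ext_presentation (F : fieldType) (L : saa F) (e : bidx -> L) :
  standard_basis e ->
  (forall k z, (2 < k <= 5)%N -> prd (e (X k)) z = 0) ->
  prd (e (X 2)) (e (X 1)) = 0 ->
  (forall k, (0 < k <= 3)%N -> prd (e (X 2)) (e (Y k)) = 0) ->
  prd (e (X 1)) (e (Y 1)) = 0 ->
  prd (e (X 1)) (e (Y 2)) = e (X 4) -> prd (e (X 1)) (e (Y 3)) = 0 ->
  prd (e (Y 1)) (e (Y 2)) = e (X 5) -> prd (e (Y 1)) (e (Y 3)) = e (X 5) ->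
  let t i j k := triple (e i) (e j) (e k) in
  presented e (P10_36_ext (t (X 2) (Y 4) (Y 5)) (t (X 1) (Y 4) (Y 5))
    (t (Y 1) (Y 4) (Y 5)) (t (Y 2) (Y 3) (Y 4)) (t (Y 2) (Y 3) (Y 5))
    (t (Y 2) (Y 4) (Y 5)) (t (Y 3) (Y 4) (Y 5))).
Proof.
move=> st cen x21 x2y x1y1 x1y2 x1y3 y1y2 y1y3 t; set P := P10_36_ext _ _ _ _ _ _ _.
have se := proj2 st.
split=> [u v w c|].
  rewrite !inE; do ![case/orP]; move=> /eqP[-> -> -> ->] //;
  by rewrite /triple ?x1y2 ?y1y2 ?y1y3 (sformJ se).
pose listed i j k := has (fun p => perm_eq [:: i; j; k] [:: p.1.1.1; p.1.1.2; p.1.2]) P.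
pose Q i j k := listed i j k \/ triple (e i) (e j) (e k) = 0.
have perm_listed i j k i' j' k' : perm_eq [:: i; j; k] [:: i'; j'; k'] ->
    listed i j k -> listed i' j' k'.
  by rewrite perm_sym => pe /hasP[p pin pp]; apply/hasP; exists p => //;
    apply: perm_trans pe pp.
suff {}Q' : forall i j k, Q i j k.
  move=> u v w np; case: (Q' u v w) => // /hasP[[[[a b] c] x] pin] /=.
  by rewrite (negPf (np _ _ _ _ pin)).
apply: alternating_ind => [i j k|i j k|i k|m n p].
- case=> [l|E]; [left|right]; last by rewrite tripleC E oppr0.
  by apply: perm_listed l; apply/permP => p /=; lia.
- case=> [l|E]; [left|right]; last by rewrite -triple_cyc.
  by apply: perm_listed l; apply/permP => p /=; lia.
- by right; rewrite triplexx.
move=> mnp p10; have m10 : (m < 10)%N by lia.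
move: m10 mnp p10.
move: m => [|[|[|[|[|[|[|[|[|[|m]]]]]]]]]] // _; move: n => [|[|[|[|[|[|[|[|[|[|n]]]]]]]]]] //;
move: p => [|[|[|[|[|[|[|[|[|[|p]]]]]]]]]] // _ _; rewrite /=;
by [ left
   | right; rewrite /triple ?(cen 3) ?(cen 4) ?(cen 5) // ?x21 ?x2y // ?x1y1 ?x1y2 ?x1y3
     ?y1y2 ?y1y3 ?linear0l ?(sformJ se)].
Qed.

(** * Diagonalising tau in an adapted basis *)

(** If f - a were injective, the cofactor of X - a in the minimal polynomial
    would already annihilate f. *)
Lemma minpoly_root_eigenvector (F : fieldType) (V : vectType F) (f : 'End(V))
    (p : {poly F}) (a : F) :
  is_minpoly p f -> root p a -> exists2 w, w != 0 & f w = a *: w.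
Proof.
move=> [monp annp minp] /factor_theorem[q pE].
have q0 : q != 0.
  by apply: contra_eq_neq pE => ->; rewrite mul0r; apply: monic_neq0.
have szp : size p = (size q).+1 by rewrite pE size_Mmonic ?monicXsubC // size_XsubC addn2.
pose g := (f - a *: \1)%VF.
have gE v : g v = f v - a *: v by rewrite add_lfunE opp_lfunE scale_lfunE id_lfunE.
have [ker0|ker] := eqVneq (lker g) 0%VS; last first.
  exists (vpick (lker g)); first by rewrite vpick0.
  have := memv_pick (lker g); rewrite memv_ker gE subr_eq0 => /eqP; exact.
suff /minp/(dvdp_leq q0) : annihilates q f by rewrite szp ltnn.
move=> v; set S := \sum_(i < size q) _.
apply/eqP; rewrite -memv0 -ker0 memv_ker gE -(annp v) szp pE.
under eq_bigr do rewrite mulrBr coefB coefMC coefMX mulrC scalerBl -scalerA.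
rewrite sumrB -scaler_sumr big_ord_recl scale0r add0r.
rewrite [X in _ == _ - _ *: X]big_ord_recr /= nth_default // scale0r addr0.
by rewrite /S linear_sum; apply/eqP; congr (_ - _); apply: eq_bigr => i _; rewrite linearZ.
Qed.

Section Adapted.
Variables (F : fieldType) (L : saa F) (e : bidx -> L).
Hypotheses (st : standard_basis e) (ae : adapted e).
Hypothesis L32 : mulV (lcs L 3) (lcs L 2) = lcs L 5.

Let x1 := e (X 1).
Let y1 := e (Y 1).
Let y2 := e (Y 2).
Let y3 := e (Y 3).

Lemma adapted_centralX k z : (2 < k <= 5)%N -> prd (e (X k)) z = 0.
Proof.
case: ae => E5 E1 _ _ _ kP.
suff /mem_ann_mod/(_ z) : e (X k) \in centre L by rewrite memv0 => /eqP.
rewrite E1 E5; case: k kP => [|[|[|[|[|[|k]]]]]] // _.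
- by apply: subvP (memv_line _); exact: addvSr.
- by apply: (subvP (addvSl _ _)); apply: subvP (memv_line _); exact: addvSr.
- by apply: (subvP (addvSl _ _)); apply: subvP (memv_line _); exact: addvSl.
Qed.

(** This is L^4 Z_4(L) = 0. *)
Lemma adapted_x2 z : z \in ucs L 4 -> prd (e (X 2)) z = 0.
Proof.
apply: lcs_ucs0; case: ae => _ _ [_ ->] _ _.
by apply: subvP (memv_line _); exact: addvSr.
Qed.

Lemma adapted_L3 s t : s *: x1 + t *: y1 \in lcs L 3.
Proof.
case: ae => _ _ _ [_ E3] _; rewrite memvD ?memvZ // E3.
  exact: mem_mid.
by apply: subvP (memv_line _); exact: addvSr.
Qed.

(** L^5 = L^3 L^2, and both L^3 L^3 and L^4 y_2 vanish: only the products of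
    x_1 and y_1 with y_2 contribute. *)
Lemma adapted_L5_mul v : v \in lcs L 5 ->
  exists s t : F, v = prd (s *: x1 + t *: y1) y2.
Proof.
have sub : (lcs L 5 <= right_mul y2 @: (<[x1]> + <[y1]>))%VS.
  case: (ae) => _ _ _ [Z3 E3] [E2 _].
  rewrite -L32; apply/mulVP => a b; rewrite {1}E3 E2.
  case/memv_addP => [c /memv_addP[d dL [_ /vlineP[s ->] ->]] [_ /vlineP[t ->] ->]].
  case/memv_addP => [b' b'L [_ /vlineP[q ->] ->]].
  have aL : d + s *: x1 + t *: y1 \in lcs L 3.
    by rewrite E3; do 2!(apply: memv_add; rewrite ?memvZ ?memv_line //).
  rewrite linearDr (L33 ae aL b'L) add0r linearZr_LR /= memvZ // -addrA linearDl /=.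
  have -> : prd d y2 = 0 by apply: (lcs_ucs0 dL); apply: (@Y_Z4 _ _ _ ae 2).
  rewrite add0r -right_mulE memv_img // memv_add ?memvZ ?memv_line //.
move/(subvP sub)/memv_imgP => [u /memv_addP[_ /vlineP[s ->] [_ /vlineP[t ->] ->]] ->].
by exists s, t; rewrite right_mulE.
Qed.

Lemma tau_eigenvector a w : w != 0 -> tau e w = a *: w ->
  exists s t : F, let u := s *: x1 + t *: y1 in
    prd u y2 != 0 /\ prd u y3 = a *: prd u y2.
Proof.
move=> w0 tw; have [s [t E]] := adapted_L5_mul (subvsP w).
exists s, t => u; have uL : u \in lcs L 3 := adapted_L3 s t.
have := tauE st ae L32 uL; rewrite -/y2 -/u -E vsvalK tw linearZ /= => <-.
by split=> //; rewrite -(subr0 (vsval w)) -(linear0 vsval) subr_eq0 (inj_eq val_inj).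
Qed.

Lemma adapted_L5_coord v : v \in lcs L 5 ->
  exists m n : F, v = m *: e (X 4) + n *: e (X 5).
Proof.
case: ae => -> _ _ _ _ /memv_addP[_ /vlineP[n ->] [_ /vlineP[m ->] ->]].
by exists m, n; rewrite addrC.
Qed.


(** A dependency between u y_2 and v y_2 would, multiplied by y_3 instead, give
    a second one weighted by the distinct eigenvalues; hence u y_2 and v y_2 are
    independent, so u and v are, and (u, v) is the nonzero determinant that can
    be scaled to 1. *)
Lemma tau_eigenbasis a b (f : {poly F}) :
  is_minpoly f (tau e) -> root f a -> root f b -> a != b ->
  exists p q p' q' : F,
    let u := p *: x1 + q *: y1 in let v := p' *: x1 + q' *: y1 in
    [/\ p * q' - q * p' = 1, prd u y3 = a *: prd u y2, prd v y3 = b *: prd v y2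
      & forall c d : F, c *: prd u y2 + d *: prd v y2 = 0 -> c = 0 /\ d = 0].
Proof.
move=> mf ra rb ab.
have [w w0 /(tau_eigenvector w0)[p [q [u0 ua]]]] := minpoly_root_eigenvector mf ra.
have [w' w'0 /(tau_eigenvector w'0)[p' [q' [v0 vb]]]] := minpoly_root_eigenvector mf rb.
set u := p *: x1 + q *: y1 in u0 ua; set v := p' *: x1 + q' *: y1 in v0 vb.
have indep c d : c *: prd u y2 + d *: prd v y2 = 0 -> c = 0 /\ d = 0.
  move=> E2.
  have E3 : (c * a) *: prd u y2 + (d * b) *: prd v y2 = 0.
    rewrite -!scalerA -ua -vb -!linearZl_LR -linearDl /=.
    apply: (ker_y2 st ae L32); first by rewrite memvD // memvZ // adapted_L3.
    by rewrite linearDl !linearZl_LR.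
  have d0 : d = 0.
    have : (d * (b - a)) *: prd v y2 = 0.
      rewrite mulrBr scalerBl; apply/eqP; rewrite subr_eq0; apply/eqP.
      move/eqP: E3; rewrite addrC addr_eq0 => /eqP ->.
      move/eqP: E2; rewrite addrC addr_eq0 => /eqP E2.
      by rewrite [d * a]mulrC -[RHS]scalerA E2 scalerN scalerA [a * c]mulrC.
    move/eqP; rewrite scaler_eq0 (negPf v0) orbF mulf_eq0 subr_eq0.
    by rewrite (eq_sym b) (negPf ab) orbF => /eqP.
  split=> //; move/eqP: E2; rewrite d0 scale0r addr0 scaler_eq0 (negPf u0) orbF.
  by move/eqP.
have D0 : p * q' - q * p' != 0.
  apply/eqP => D0.
  have Ex : p' *: u - p *: v = 0.
    rewrite /u /v !scalerDr !scalerA [p' * p]mulrC opprD addrACA subrr add0r.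
    by rewrite -scalerBl -[_ - _]opprK opprB [p' * q]mulrC D0 oppr0 scale0r.
  have Ey : q' *: u - q *: v = 0.
    rewrite /u /v !scalerDr !scalerA [q' * q]mulrC opprD addrACA subrr addr0.
    by rewrite -scalerBl [q' * p]mulrC D0 scale0r.
  have z c d : c *: u - d *: v = 0 -> c = 0 /\ d = 0.
    move=> E; have [] := indep c (- d).
      by rewrite -!linearZl_LR -linearDl /= scaleNr E linear0l.
    by move=> -> /eqP; rewrite oppr_eq0 => /eqP ->.
  have [p'0 p0] := z _ _ Ex; have [q'0 q0] := z _ _ Ey.
  by move: u0; rewrite /u p0 q0 !scale0r addr0 linear0l eqxx.
set D := p * q' - q * p' in D0.
have vE : (D^-1 * p') *: x1 + (D^-1 * q') *: y1 = D^-1 *: v.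
  by rewrite /v scalerDr !scalerA.
exists p, q, (D^-1 * p'), (D^-1 * q'); rewrite vE; split=> //.
- by rewrite /D; field.
- by rewrite !linearZl_LR /= vb !scalerA mulrC.
move=> c d; rewrite linearZl_LR /= scalerA => /indep[-> /eqP].
by rewrite mulf_eq0 invr_eq0 (negPf D0) orbF => /eqP ->.
Qed.

(** The new basis starts from the eigenbasis u, v. The combination
    (y_3 - a y_2) / (b - a) kills u and sends v to v y_2; the corrections of x_2
    and x_3, and the choice of y_4 and y_5, are forced by duality. *)
Lemma adapted_presentation a b (f : {poly F}) :
  is_minpoly f (tau e) -> root f a -> root f b -> a != b ->
  exists r : F, r != 0 /\ has_presentation L (P10_36 r).
Proof.
move=> mf ra rb ab; have se := proj2 st.
have [p [q [p' [q' [D1 ua vb indep]]]]] := tau_eigenbasis mf ra rb ab.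
set u := p *: x1 + q *: y1 in ua indep; set v := p' *: x1 + q' *: y1 in vb indep.
have uL : u \in lcs L 3 by apply: adapted_L3.
have vL : v \in lcs L 3 by apply: adapted_L3.
have [m [n Eu]] := adapted_L5_coord (L3_y2 ae L32 uL).
have [m' [n' Ev]] := adapted_L5_coord (L3_y2 ae L32 vL).
rewrite -/y2 in Eu Ev.
have D0 : m * n' - n * m' != 0.
  apply/eqP => D0.
  have z c d : c * m = d * m' -> c * n = d * n' -> c = 0 /\ d = 0.
    move=> Em En; have [] := indep c (- d).
      rewrite Eu Ev !scalerDr !scalerA addrACA -!scalerDl Em En !mulNr !subrr.
      by rewrite !scale0r addr0.
    by move=> -> /eqP; rewrite oppr_eq0 => /eqP ->.
  have D0' : m * n' = n * m' by apply/eqP; rewrite -subr_eq0 D0.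
  have Dn : m' * n = m * n' by rewrite D0' mulrC.
  have [m'0 m0] := z m' m (mulrC _ _) Dn.
  have Dm : n' * m = n * m' by rewrite mulrC D0'.
  have [n'0 n0] := z n' n Dm (mulrC _ _).
  have [||/eqP] := z 1 0; rewrite ?m0 ?n0 ?mulr0 ?mul0r //.
  by rewrite oner_eq0.
have ba0 : b - a != 0 by rewrite subr_eq0 eq_sym.
pose e' := basis_of_seqs
  [:: u; e (X 2) + a *: e (X 3); (b - a) *: e (X 3); prd u y2; prd v y2]
  [:: v; y2; (b - a)^-1 *: (y3 - a *: y2);
      (m * n' - n * m')^-1 *: (n' *: e (Y 4) - m' *: e (Y 5));
      (m * n' - n * m')^-1 *: (m *: e (Y 5) - n *: e (Y 4))].
have se' : symplectic e'.
  apply: symplecticP => -[|[|[|[|[|[|i]]]]]] // [|[|[|[|[|[|j]]]]]] // _ _;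
  split; first [done | move=> _ | idtac]; rewrite /e' /= ?Eu ?Ev /u /v /x1 /y1 /y2 /y3;
  rewrite ?(linearDl, linearNl, linearZl_LR) /=;
  rewrite ?(linearDl, linearNl, linearZl_LR) /=;
  rewrite ?(linearDr, linearNr, linearZr_LR) /=;
  rewrite ?(linearDr, linearNr, linearZr_LR) /= ?(sformJ se) /=;
  first [done | by rewrite -[RHS]D1; ring | by field; rewrite ?D0 ?ba0].
have d10 := standard_dim st; have st' := standard_of_dim se' d10.
have y2Z : y2 \in ucs L 4 by apply: (@Y_Z4 _ _ _ ae 2).
have cen k z : (2 < k <= 5)%N -> prd (e (X k)) z = 0 by exact: adapted_centralX.
have uZ s t : s *: x1 + t *: y1 \in ucs L 4.
  by rewrite memvD // memvZ //; [apply: (X_Z4 ae (k := 1)) | apply: (Y_Z4 ae (k := 1))].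
have pre := ext_presentation st'.
have cen' k z : (2 < k <= 5)%N -> prd (e' (X k)) z = 0.
  case: k => [|[|[|[|[|[|k]]]]]] // _; rewrite /e' /= ?Eu ?Ev;
  by rewrite ?linearDl !linearZl_LR /= ?(cen 3) ?(cen 4) ?(cen 5) ?scaler0 ?addr0.
have x2E z : prd (e' (X 2)) z = prd (e (X 2)) z.
  by rewrite /e' /= linearDl linearZl_LR /= (cen 3) // scaler0 addr0.
have x2x1 : prd (e' (X 2)) (e' (X 1)) = 0 by rewrite x2E; apply: adapted_x2; apply: uZ.
have x2y k : (0 < k <= 3)%N -> prd (e' (X 2)) (e' (Y k)) = 0.
  move=> kP; rewrite x2E; apply: adapted_x2.
  case: k kP => [|[|[|[|k]]]] // _; rewrite /e' /= ?uZ //.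
  by rewrite memvZ // memvB ?memvZ //; apply: (@Y_Z4 _ _ _ ae 3).
have x1y1 : prd (e' (X 1)) (e' (Y 1)) = 0 by apply: (L33 ae).
have x1y3 : prd (e' (X 1)) (e' (Y 3)) = 0.
  by rewrite /e' /= linearZr_LR linearBr linearZr_LR /= ua subrr scaler0.
have y1y3 : prd (e' (Y 1)) (e' (Y 3)) = e' (X 5).
  rewrite /e' /= linearZr_LR linearBr linearZr_LR /= vb -scalerBl scalerA.
  by rewrite mulVf // scale1r.
have [on off] := pre cen' x2x1 x2y x1y1 erefl x1y3 erefl y1y3.
set r := triple (e' (X 2)) _ _ in on off.
(* Otherwise the new x_2 would be central, but the centre is orthogonal to y_2. *)
have r0 : r != 0.
  apply/eqP => r0.
  have T' := presented_triples st' (isT : reduced (P10_36_ext _ _ _ _ _ _ _)) (conj on off).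
  have : e' (X 2) \in centre L.
    apply/mem_ann_mod => z; rewrite memv0; apply/eqP; apply: form_nondeg => w.
    rewrite -/(triple _ _ _) T' coords_basis // r0 /presentation_form.
    by rewrite !big_cons big_nil /= /wedge !model_basisE /=; ring.
  case: (ae) => E5 E1 _ _ _; rewrite E1 E5.
  case/memv_addP => [_ /memv_addP[_ /vlineP[c5 ->] [_ /vlineP[c4 ->] ->]] [_ /vlineP[c3 ->]]].
  move/(congr1 (fun z => sform z y2)); rewrite /e' /= !linearDl !linearZl_LR /=.
  rewrite !(sformJ se) /= !mulr0 !addr0 => /eqP.
  by rewrite oner_eq0.
exists r; split=> //.
exact: clear_presentation r0 (ex_intro _ e' (And3 st' on off)).
Qed.
End Adapted.

Theorem proposition4p11 (F : fieldType) :
  (forall L : saa F,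
     nilpotent_saa L ->
     \dim (fullv : {vspace L}) = 10%N ->
     isotropic (centre L) ->
     \dim (centre L) = 3%N ->
     \dim (lcs L 3) = 6%N ->
     mulV (lcs L 3) (lcs L 2) = lcs L 5 ->
     type_A L ->
     exists r : F, r != 0 /\ has_presentation L (P10_36 r)) /\
  (forall r s : F, r != 0 -> s != 0 ->
     forall L M : saa F,
       has_presentation L (P10_36 r) -> has_presentation M (P10_36 s) ->
       (saa_iso L M <-> exists b : F, b != 0 /\ s / r = b ^+ 3)).
Proof.
split=> [L _ _ _ _ _ L32 [e [st ae [f mf [a [b [ab ra rb]]]]]]|r s r0 s0 L M Lr Ms].
  exact: (adapted_presentation st ae L32 mf ra rb ab).
split=> [LM|[b [b0 srb]]].
  exact: (parameters_mod_cubes r0 s0 (saa_iso_has_presentation LM Lr) Ms).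
apply: (saa_iso_of_presentation (P10_36_reduced s) _ Ms).
have -> : s = r * b ^+ 3 by rewrite -srb; field.
exact: has_presentation_scaled.
Qed.
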